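(* Let $\Gamma$ be a discrete group equipped with a proper length function $|\cdot|$, let $\Lambda<\Gamma$ be a subgroup, and endow $X=\Gamma/\Lambda$ with the left $\Gamma$-invariant distance function $$d(s\Lambda,t\Lambda)=\inf_{\lambda,\lambda'\in\Lambda}|\lambda s^{-1}t\lambda'|.$$ Then $X$ is of bounded geometry if and only if $(\Gamma,\Lambda)$ is a Hecke pair.
   Context: Proper length: $|\cdot|:\Gamma\to[0,\infty)$ with $|\gamma|=0$ iff $\gamma=e$, $|\gamma^{-1}|=|\gamma|$, $|\gamma\gamma'|\le|\gamma|+|\gamma'|$, and $\{\gamma:|\gamma|\le r\}$ finite for every $r$. $(X,d)$ is of bounded geometry if for every $r>0$, $\sup_{x\in X}|B(x,r)|<\infty$, where $B(x,r)=\{y\in X:d(x,y)\le r\}$. $(\Gamma,\Lambda)$ is a Hecke pair (equivalently, $\Lambda$ is almost normal in $\Gamma$) if $[\Lambda:\Lambda\cap\gamma\Lambda\gamma^{-1}]<\infty$ for every $\gamma\in\Gamma$; equivalently, $\Lambda$ and $\gamma\Lambda\gamma^{-1}$ are commensurable for every $\gamma\in\Gamma$; equivalently, the left action of $\Lambda$ on $\Gamma/\Lambda$ has finite orbits; equivalently, every double coset $\Lambda s\Lambda$ is a finite union of cosets $\gamma\Lambda$. *)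

(* Defs.v *)
From HB Require Import structures.
From mathcomp Require Import all_boot all_order all_algebra.
From mathcomp Require Import all_classical all_reals all_analysis.

Set Implicit Arguments.
Unset Strict Implicit.
Unset Printing Implicit Defensive.

Import Order.TTheory GRing.Theory Num.Theory.

Local Open Scope classical_set_scope.
Local Open Scope quotient_scope.
Local Open Scope ring_scope.

(* Groups are multiplicative and possibly infinite ([groupType]), with group
   operations in [group_scope] (%g); "discrete" means that no topology is put
   on them. Subgroups are the predicates of type [groupClosed G]. *)

Section ProperLength.
Variables (R : realType) (G : groupType).

Record proper_length (len : G -> R) : Prop := ProperLength {
  len_ge0 : forall g, 0 <= len g ;
  len_eq0 : forall g, len g = 0 <-> g = 1%g ;
  lenV : forall g, len g^-1%g = len g ;
  lenM : forall g h, len (g * h)%g <= len g + len h ;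
  len_proper : forall r : R, finite_set [set g | len g <= r]
}.

End ProperLength.

Section BoundedGeometry.
Variables (R : realType) (X : choiceType) (d : X -> X -> R).

(* No metric axiom is imposed on d: the function [coset_dist] below need not
   satisfy the triangle inequality. *)
Definition dball (x : X) (r : R) : set X := [set y | d x y <= r].

Definition bounded_geometry : Prop :=
  forall r : R, 0 < r ->
    (ereal_sup [set @counting X R (dball x r) | x in [set: X]] < +oo)%E.

End BoundedGeometry.

Section Hecke.
Variable G : groupType.

Definition lcoset (s : G) (A : set G) : set G := [set (s * a)%g | a in A].

Definition conjset (s : G) (A : set G) : set G :=
  [set (s * a * s^-1)%g | a in A].

(* [H : K] is the number of left cosets hK with h in H (for K a subgroup
   of H). *)
Definition finite_index (H K : set G) : Prop :=
  finite_set [set lcoset h K | h in H].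

Definition hecke_pair (L : groupClosed G) : Prop :=
  forall g : G, finite_index [set` L] ([set` L] `&` conjset g [set` L]).

End Hecke.

Section CosetSpace.
Variables (G : groupType) (L : groupClosed G).

Definition lcoset_eq (s t : G) : bool := (s^-1 * t)%g \in L.

Lemma lcoset_eq_equiv : equiv_class_of lcoset_eq.
Proof.
split => [s|s t|t s u]; rewrite /lcoset_eq.
- by rewrite mulVg gpred1.
- by rewrite -gpredV invgM invgK.
- by move=> st tu; rewrite -(mulVKg t u) mulgA gpredM.
Qed.

Canonical lcoset_equiv := EquivRelPack lcoset_eq_equiv.

Definition coset_space := {eq_quot lcoset_equiv}.

Definition coset (s : G) : coset_space := \pi_coset_space s.

Lemma pi_cosetP (s t : G) : reflect (coset s = coset t) (s^-1 * t \in L)%g.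
Proof. exact: (@eqquotP _ _ coset_space). Qed.

Lemma coset_lcosetP (s t : G) :
  coset s = coset t <-> lcoset s [set` L] = lcoset t [set` L].
Proof.
split=> [/pi_cosetP st|st].
  have ts : (t^-1 * s \in L)%g by rewrite -gpredV invgM invgK.
  apply/seteqP; split=> _ [a /= aL <-].
    exists (t^-1 * s * a)%g; first exact: gpredM.
    by rewrite !mulgA mulgV mul1g.
  exists (s^-1 * t * a)%g; first exact: gpredM.
    by rewrite !mulgA mulgV mul1g.
apply/pi_cosetP; have : lcoset t [set` L] t.
  by exists 1%g; [exact: gpred1 | rewrite mulg1].
by rewrite -st => -[a /= aL <-]; rewrite mulgA mulVg mul1g.
Qed.

Section CosetDist.
Variables (R : realType) (len : G -> R).

(* d(sL, tL), computed on chosen representatives s and t of the cosets; by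
   [coset_distE] the choice is irrelevant. *)
Definition coset_dist (x y : coset_space) : R :=
  inf [set len (l * (repr x)^-1 * repr y * l')%g |
         l in [set` L] & l' in [set` L]].

Lemma coset_distE (s t : G) :
  coset_dist (coset s) (coset t) =
  inf [set len (l * s^-1 * t * l')%g | l in [set` L] & l' in [set` L]].
Proof.
have reprE u : exists2 k, k \in L & repr (coset u) = (u * k)%g.
  exists (u^-1 * repr (coset u))%g; last by rewrite mulgA mulgV mul1g.
  by apply/pi_cosetP; rewrite /coset reprK.
rewrite /coset_dist; have [k kL ->] := reprE s; have [m mL ->] := reprE t.
congr inf; apply/seteqP; split=> _ [l /= lL [l' /= l'L <-]].
- exists (l * k^-1)%g; first by rewrite /= gpredM ?gpredV.
  by exists (m * l')%g; [exact: gpredM | rewrite invgM !mulgA].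
- exists (l * k)%g; first by rewrite /= gpredM.
  exists (m^-1 * l')%g; first by rewrite /= gpredM ?gpredV.
  by rewrite invgM -!mulgA !mulVKg.
Qed.

Lemma coset_dist_invariant (g s t : G) :
  coset_dist (coset (g * s)%g) (coset (g * t)%g) =
  coset_dist (coset s) (coset t).
Proof.
rewrite !coset_distE; congr inf; apply/seteqP.
by split=> _ [l lL [l' l'L <-]]; exists l => //; exists l' => //;
  rewrite invgM -!mulgA mulKg.
Qed.

End CosetDist.

End CosetSpace.

(* Main.v *)
(* A ball of radius r around s Lambda is covered by the translates by s of the
   sets (Lambda g Lambda) / Lambda with |g| <= r + 1, and conversely the ball of
   radius |g| around Lambda contains (Lambda g Lambda) / Lambda. As there are
   finitely many g with |g| <= r + 1, bounded geometry amounts to the finiteness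
   of every (Lambda g Lambda) / Lambda; this set is the orbit of g Lambda under
   Lambda, in bijection with the cosets in Lambda of the stabilizer
   Lambda \cap g Lambda g^-1. *)
Require Import Defs.
From mathcomp Require Import all_boot all_order all_algebra finmap.
From mathcomp Require Import all_classical all_reals all_analysis.

Set Implicit Arguments.
Unset Strict Implicit.
Unset Printing Implicit Defensive.

Import Order.TTheory GRing.Theory Num.Theory.

Local Open Scope classical_set_scope.
Local Open Scope ring_scope.

Section UniformlyFiniteSets.
Variables (R : realType) (T : choiceType).

Lemma counting_lty (A : set T) :
  (@counting T R A < +oo)%E -> finite_set A.
Proof. by rewrite /counting; case: asboolP. Qed.

(** The bound does not involve [f]: a family of sets covered by different images of one finite [B]
    has uniformly bounded cardinality. *)
Lemma counting_image_le (U : choiceType) (f : U -> T) (B : set U) (A : set T) :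
  finite_set B -> A `<=` f @` B ->
  (@counting T R A <= @counting U R B)%E.
Proof.
move=> finB AfB.
have finfB := finite_image f finB; have finA := sub_finite_set AfB finfB.
rewrite /counting !asboolT// lee_fin ler_nat.
apply: (@leq_trans #|` fset_set (f @` B)|).
  by apply: fsubset_leq_card; rewrite -fset_set_sub.
by rewrite fset_set_image// leq_imfset_card.
Qed.

End UniformlyFiniteSets.

Section CosetGeometry.
Variables (R : realType) (G : groupType) (L : groupClosed G).

Definition dcoset_lcosets (g : G) : set (coset_space L) :=
  [set coset L (l * g)%g | l in [set` L]].

(** Orbit-stabilizer: [L] meets its conjugate by [g] in the stabilizer of [gL], whose left cosets
    are the fibres of the orbit map sending [x] to [xgL]. *)
Lemma lcoset_stabilizerE (g l : G) : l \in L ->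
  lcoset l ([set` L] `&` conjset g [set` L]) =
  [set x | x \in L /\ coset L (x * g)%g = coset L (l * g)%g].
Proof.
move=> lL; apply/seteqP; split=> [_ [k [/= kL [a /= aL ka]] <-]|x /= [xL]].
  split; first by rewrite gpredM.
  rewrite -ka; apply/pi_cosetP.
  by rewrite !invgM !invgK -!mulgA !(mulKg, mulVKg) mulVg mulg1 gpredV.
move=> /esym/pi_cosetP; rewrite invgM -!mulgA => aL.
exists (l^-1 * x)%g; last by rewrite mulVKg.
split; first by rewrite /= gpredM ?gpredV.
by exists (g^-1 * (l^-1 * (x * g)))%g; rewrite // -!mulgA mulVKg mulgV mulg1.
Qed.

Lemma finite_index_stabilizer (g : G) :
  finite_index [set` L] ([set` L] `&` conjset g [set` L]) <->
  finite_set (dcoset_lcosets g).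
Proof.
pose fiber (c : coset_space L) := [set x | x \in L /\ coset L (x * g)%g = c].
have -> : finite_index [set` L] ([set` L] `&` conjset g [set` L]) =
          finite_set (fiber @` dcoset_lcosets g).
  rewrite /finite_index /dcoset_lcosets image_comp; congr finite_set.
  by apply: eq_imagel => l /= lL; rewrite lcoset_stabilizerE.
split=> [fin|]; last exact: finite_image.
(* The orbit map sends each fibre into a single point, so finitely many fibres leave finitely many
   points; each [l] lies in the fibre over its own [lgL], so no point of the orbit is missed. *)
have : finite_set (\bigcup_(A in fiber @` dcoset_lcosets g)
                     ((fun x => coset L (x * g)%g) @` A)).
  apply: bigcup_finite => // _ [c _ <-].
  by apply: (sub_finite_set _ (finite_set1 c)) => _ [x [_ <-] <-].
apply: sub_finite_set => _ [l /= lL <-].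
exists (fiber (coset L (l * g)%g)); last by exists l.
by exists (coset L (l * g)%g) => //; exists l.
Qed.

Section Metric.
Variables (len : G -> R) (lenP : proper_length len).

Lemma coset_dist_le (s t l l' : G) : l \in L -> l' \in L ->
  coset_dist len (coset L s) (coset L t) <= len (l * s^-1 * t * l')%g.
Proof.
move=> lL l'L; rewrite coset_distE; apply: ge_inf.
  by exists 0 => _ [k _ [k' _ <-]]; apply: len_ge0.
by exists l => //; exists l'.
Qed.

(** The strict inequality yields actual [l] and [l'] without showing that the infimum is attained;
    hence the slack [r + 1] for closed balls below. *)
Lemma coset_dist_lt (s t : G) (r : R) :
  coset_dist len (coset L s) (coset L t) < r ->
  exists l l', [/\ l \in L, l' \in L & len (l * s^-1 * t * l')%g < r].
Proof.
rewrite coset_distE => /inf_lt[|_ [l lL [l' l'L <-]] ltr]; last by exists l, l'.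
exists (len (1 * s^-1 * t * 1)%g), 1%g; first exact: gpred1.
by exists 1%g; first exact: gpred1.
Qed.

Lemma dcoset_sub_dball (g : G) :
  dcoset_lcosets g `<=` dball (coset_dist len) (coset L 1%g) (len g).
Proof.
move=> _ [l /= lL <-]; rewrite /dball/=.
have lVL : (l^-1)%g \in L by rewrite gpredV.
have := coset_dist_le 1%g (l * g)%g lVL (gpred1 : 1%g \in L).
by rewrite invg1 !mulg1 mulKg.
Qed.

(** The centre [s] enters only through the translation; the union being translated depends on [r]
    alone. *)
Lemma dball_sub_dcosets (s : G) (r : R) :
  dball (coset_dist len) (coset L s) r `<=`
  (fun c => coset L (s * repr c)%g) @`
    \bigcup_(g in [set g | len g <= r + 1]) dcoset_lcosets g.
Proof.
move=> y; rewrite -(reprK y) /dball/= -/(coset L (repr y)).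
move: (repr y) => t {y} dr.
have [l [l' [lL l'L /ltW lenr]]] : exists l l',
    [/\ l \in L, l' \in L & len (l * s^-1 * t * l')%g < r + 1].
  by apply: coset_dist_lt; rewrite (le_lt_trans dr)// ltrDl.
(* With [g = l * s^-1 * t * l'], this coset is that of [l^-1 * g], and translation by [s] sends it
   to [tL]. *)
exists (coset L (s^-1 * t)%g).
  exists (l * s^-1 * t * l')%g => //; exists l^-1%g; first by rewrite /= gpredV.
  apply/pi_cosetP; rewrite -!mulgA mulKg !invgM invgK -!mulgA.
  by rewrite !(mulKg, mulVKg) mulVg mulg1 gpredV.
apply/pi_cosetP; rewrite invgM -mulgA; apply/pi_cosetP.
by rewrite /coset reprK.
Qed.

End Metric.

End CosetGeometry.

Theorem proposition2p1 (R : realType) (G : groupType) (len : G -> R)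
    (len_proper_length : proper_length len) (L : groupClosed G) :
  bounded_geometry (coset_dist (L := L) len) <-> hecke_pair L.
Proof.
split=> [bounded g|hecke r _].
- apply/finite_index_stabilizer.
  (* [bounded_geometry] speaks of positive radii only, and [len g] vanishes at [g = 1]. *)
  have len1_gt0 : 0 < len g + 1 by rewrite ltr_wpDl// len_ge0.
  have finB : finite_set (dball (coset_dist len) (coset L 1%g) (len g + 1)).
    apply: (@counting_lty R); apply: le_lt_trans (bounded _ len1_gt0).
    by apply: ereal_sup_ubound; exists (coset L 1%g).
  apply: sub_finite_set finB => c /(dcoset_sub_dball len_proper_length).
  by move=> /le_trans; apply; rewrite lerDl.
- pose D := \bigcup_(g in [set g | len g <= r + 1]) dcoset_lcosets (L := L) g.
  have finD : finite_set D.
    apply: bigcup_finite => [|g _]; first exact: len_proper.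
    by apply/finite_index_stabilizer/hecke.
  (* The cardinality of [D] bounds all balls of radius [r] at once, hence their supremum. *)
  apply: (@le_lt_trans _ _ (@counting _ R D)); last first.
    by rewrite /counting asboolT// ltry.
  apply: ge_ereal_sup => _ [x _ <-]; rewrite -(reprK x).
  exact: counting_image_le finD (@dball_sub_dcosets _ _ _ _ _ _).
Qed.
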